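(* Let $E$ be a non-zero Banach space. The map $\star\mapsto e_\star$ from $\mathrm{Mltp}_{\mathrm{u}}(E)$ to $E$ is continuous. Moreover, if $\star\in\mathrm{Mltp}_{\mathrm{u}}(E)$ converges to a point in the boundary of $\mathrm{Mltp}_{\mathrm{u}}(E)$ in $\mathrm{Mltp}(E)$, then $\|e_\star\|$ converges to $\infty$; that is, for every point $\star_0$ of the topological boundary of $\mathrm{Mltp}_{\mathrm{u}}(E)$ relative to $\mathrm{Mltp}(E)$ and every sequence $(\star_n)_n$ in $\mathrm{Mltp}_{\mathrm{u}}(E)$ converging to $\star_0$, one has $\|e_{\star_n}\|\to\infty$.
   Context: $\mathrm{B}_2(E)$ is the Banach space of bounded bilinear maps $E\times E\to E$ with the operator norm $|\varphi|=\sup\{\|\varphi(x,y)\|:\|x\|\leq1,\|y\|\leq1\}$. $\mathrm{Mltp}(E)\subset\mathrm{B}_2(E)$ is the set of continuous multiplications on $E$, i.e. of those $*\in\mathrm{B}_2(E)$ that are associative as binary operations on $E$, with the subspace topology from $\mathrm{B}_2(E)$. $\mathrm{Mltp}_{\mathrm{u}}(E)\subset\mathrm{Mltp}(E)$ is the subset (with subspace topology) of those $*$ for which $(E,* )$ has a (two-sided) unit element, denoted $e_*$. *)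

(* Defs.v *)
From HB Require Import structures.
From mathcomp Require Import all_boot all_order all_algebra.
From mathcomp Require Import all_classical all_reals all_analysis.
From mathcomp Require Import sesquilinear complex.

Set Implicit Arguments.
Unset Strict Implicit.
Unset Printing Implicit Defensive.

Import Order.TTheory GRing.Theory Num.Theory.
Import numFieldNormedType.Exports.

Local Open Scope classical_set_scope.
Local Open Scope ring_scope.

(* The ground field of the Banach space: real or complex. Norms take their
   values in this field (for complex scalars, in its nonnegative reals, for the
   order in which x <= y means that y - x is a nonnegative real). *)
Variant scalars := RealScalars | ComplexScalars.

Definition scalar_field (R : realType) (s : scalars) : numFieldType :=
  match s with
  | RealScalars => R
  | ComplexScalars => R[i]
  end.

Section scalar_supremum.
Variable R : realType.

Let real_supremum (A : set R) : has_sup A -> supremums A (supremum 0 A).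
Proof.
by move=> hA; split; [exact: sup_upper_bound | move=> y Ay; exact: ge_sup hA.1 Ay].
Qed.

Let complex_supremum (A : set R[i]) : has_sup A -> A `<=` [set x | 0 <= x] ->
  supremums A (supremum 0 A).
Proof.
move=> [[a Aa] [b Ab]] A0.
suff [c cP] : exists c, supremums A c.
  rewrite /supremum ifF; last by apply/eqP => A_0; rewrite A_0 in Aa.
  by case: xgetP => // /(_ c).
pose B : set R := [set complex.Re x | x in A].
have imA x : A x -> complex.Im x = 0.
  by move=> /A0 /=; rewrite lecE /= => /andP[/eqP].
have imub y : ubound A y -> complex.Im y = 0.
  by move=> /(_ _ Aa); rewrite lecE => /andP[/eqP-> _]; exact: imA.
have hB : has_sup B.
  split; first by exists (complex.Re a), a.
  by exists (complex.Re b) => _ [x /Ab + <-]; rewrite lecE => /andP[].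
exists (sup B)%:C%C; split.
  move=> x Ax; rewrite lecE /= (imA _ Ax) eqxx /=.
  by apply: sup_upper_bound => //; exists x.
move=> y Ay; rewrite lecE /= (imub _ Ay) eqxx /=.
apply: ge_sup; first exact: hB.1.
by move=> _ [x Ax <-]; have := Ay _ Ax; rewrite lecE => /andP[].
Qed.

Lemma scalar_supremumP (s : scalars) (A : set (scalar_field R s)) :
  has_sup A -> A `<=` [set x | 0 <= x] -> supremums A (supremum 0 A).
Proof.
by case: s A => A hA A0; [exact: real_supremum | exact: complex_supremum].
Qed.

End scalar_supremum.

Section bounded_bilinear.
Variables (R : realType) (s : scalars) (E : normedModType (scalar_field R s)).
Notation K := (scalar_field R s).
Implicit Types f : E -> E -> E.

Definition unit_ball_norms f : set K :=
  [set `|f x y| | x in [set x : E | `|x| <= 1] & y in [set y : E | `|y| <= 1]].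

Definition is_bilinear f :=
  (forall y, linear (f ^~ y)) /\ (forall x, linear (f x)).

Definition bounded_bilinear : {pred E -> E -> E} :=
  mem [set f | is_bilinear f /\ has_ubound (unit_ball_norms f)].

Definition opnorm f : K := supremum 0 (unit_ball_norms f).

Definition unit_ball_norms_neq0 f : unit_ball_norms f !=set0.
Proof.
by exists `|f 0 0|; exists 0; rewrite /= ?normr0//; exists 0; rewrite /= ?normr0.
Qed.

Lemma opnorm_lub f : has_ubound (unit_ball_norms f) ->
  supremums (unit_ball_norms f) (opnorm f).
Proof.
move=> fb; apply: scalar_supremumP; first by split=> //; exact: unit_ball_norms_neq0.
by move=> _ [x _ [y _ <-]] /=.
Qed.

Lemma opnorm_ub f x y : has_ubound (unit_ball_norms f) ->
  `|x| <= 1 -> `|y| <= 1 -> `|f x y| <= opnorm f.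
Proof. by move=> /opnorm_lub[+ _] x1 y1; apply; exists x => //; exists y. Qed.

Lemma opnorm_le f c : (forall x y, `|x| <= 1 -> `|y| <= 1 -> `|f x y| <= c) ->
  opnorm f <= c.
Proof.
move=> fc; have ubc : ubound (unit_ball_norms f) c.
  by move=> _ [x x1 [y y1 <-]]; exact: fc.
by have [_] := opnorm_lub (ex_intro _ _ ubc); apply.
Qed.

Lemma bounded_bilinear_submod_closed : submod_closed bounded_bilinear.
Proof.
split.
  apply: mem_set; split.
    by split=> [y a u v|x a u v] /=; rewrite scaler0 addr0.
  by exists 0 => _ [x _ [y _ <-]]; rewrite normr0.
move=> a f g /set_mem[[fl fr] [M fM]] /set_mem[[gl gr] [N gN]].
apply: mem_set; split.
  split=> [y b u v|x b u v] /=.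
  - rewrite /= !fctE; have /= -> := fl y b u v; have /= -> := gl y b u v.
    by rewrite !scalerDr addrACA !scalerA [a * b]mulrC.
  - rewrite /= !fctE; have /= -> := fr x b u v; have /= -> := gr x b u v.
    by rewrite !scalerDr addrACA !scalerA [a * b]mulrC.
exists (`|a| * M + N) => _ [x x1 [y y1 <-]].
rewrite (le_trans (ler_normD _ _))// lerD//; last first.
  by apply: gN; exists x => //; exists y.
by rewrite normrZ ler_wpM2l//; apply: fM; exists x => //; exists y.
Qed.

HB.instance Definition _ :=
  GRing.isSubmodClosed.Build _ _ bounded_bilinear bounded_bilinear_submod_closed.

Record B2 := BBil {
  B2_fun :> E -> E -> E;
  B2P : B2_fun \in bounded_bilinear
}.

HB.instance Definition _ := [isSub for B2_fun].
HB.instance Definition _ := [Choice of B2 by <:].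
HB.instance Definition _ := [SubChoice_isSubLmodule of B2 by <:].

Lemma B2_bounded (m : B2) : has_ubound (unit_ball_norms m).
Proof. by have /set_mem[] := B2P m. Qed.

#[local] Hint Extern 0 (has_ubound _) => exact: B2_bounded : core.

Lemma B2_bilinear (m : B2) : bilinear_for *:%R *:%R m.
Proof. by have /set_mem[[ml mr] _] := B2P m. Qed.

HB.instance Definition _ (m : B2) :=
  bilinear_isBilinear.Build K E E E *:%R *:%R m (B2_bilinear m).

Lemma opnormD (m n : B2) : opnorm (m + n : B2) <= opnorm m + opnorm n.
Proof.
apply: opnorm_le => x y x1 y1.
by rewrite (le_trans (ler_normD _ _))// lerD// opnorm_ub.
Qed.

Lemma opnormZ_le (a : K) (m : B2) : opnorm (a *: m : B2) <= `|a| * opnorm m.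
Proof. by apply: opnorm_le => x y x1 y1; rewrite normrZ ler_wpM2l// opnorm_ub. Qed.

Lemma opnormZ (a : K) (m : B2) : opnorm (a *: m : B2) = `|a| * opnorm m.
Proof.
have [->|a0] := eqVneq a 0.
  rewrite scale0r normr0 mul0r; apply/eqP; rewrite eq_le; apply/andP; split.
    by apply: opnorm_le => x y _ _; rewrite normr0.
  rewrite -(normr0 E); apply: (@opnorm_ub (0 : B2) 0 0); rewrite ?normr0//.
apply/eqP; rewrite eq_le opnormZ_le /=.
rewrite -ler_pdivlMl ?normr_gt0// -normfV.
by rewrite -[in leLHS](scalerK a0 m) opnormZ_le.
Qed.

Lemma opnorm_eq0 (m : B2) : opnorm m = 0 -> m = 0.
Proof.
move=> m0; apply/val_inj/funext => x; apply/funext => y /=.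
have [->|x0] := eqVneq x 0; first exact: linear0l.
have [->|y0] := eqVneq y 0; first exact: linear0r.
have : `|m (`|x|^-1 *: x) (`|y|^-1 *: y)| <= 0.
  by rewrite -m0 opnorm_ub// normfZV.
rewrite normr_le0 linearZl_LR linearZr_LR !scaler_eq0.
by rewrite !invr_eq0 !normr_eq0 (negbTE x0) (negbTE y0) /= => /eqP.
Qed.

HB.instance Definition _ :=
  Lmodule_isNormed.Build K B2 opnormD opnormZ opnorm_eq0.

End bounded_bilinear.

Section multiplications.
Variables (R : realType) (s : scalars) (E : normedModType (scalar_field R s)).

Definition Mltp : set (B2 E) := [set m | associative m].

Definition is_unit (m : B2 E) (e : E) := left_id e m /\ right_id e m.

Definition Mltpu : set (B2 E) := Mltp `&` [set m | exists e, is_unit m e].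

(* Meaningful only on [Mltpu], where the unit exists and is unique; the value
   is [0] when there is no unit. *)
Definition unit_elt (m : B2 E) : E := xget 0 [set e | is_unit m e].

End multiplications.
Arguments Mltp {R s} E.
Arguments Mltpu {R s} E.

Definition boundary (T : topologicalType) (A : set T) : set T :=
  closure A `\` interior A.

(* [subspace A] is [T] with the subspace topology on [A] and the points outside
   [A] isolated, so that for [B `<=` A] this is the boundary of [B] in [A]. *)
Definition boundary_in (T : topologicalType) (A B : set T) : set T :=
  @boundary (subspace A) B.

(* Main.v *)
Require Import Defs.
From mathcomp Require Import all_boot all_order all_algebra.
From mathcomp Require Import all_classical all_reals all_analysis.
From mathcomp Require Import complex.

(** Let [e] be a unit of [m] and [e'] a unit of [m'].  Then [m e e' = e'] and
    [m' e e' = e], so [e - e' = (m' - m) e e'] has norm at most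
    [`|m - m'| * `|e| * `|e'|] ([unit_dist]).  As [`|e'|] is itself at most
    [`|e| + `|e - e'|], this forces [e'] to be close to [e] when [m'] is close
    to [m], which is the continuity of the unit.

    For the boundary, the point is a lower bound, in terms of [`|e|], on the
    distance from [m] to the associative multiplications without a unit
    ([Mltpu_near_unit]): if [`|m' - m| * `|e| < 1], then the left and right
    translations by [e] for [m'] are at distance less than 1 from the identity,
    hence surjective by a Neumann series ([surjective_near_id]); and an
    associative multiplication with an element whose two translations are
    surjective has a unit.  Consequently, if [m n] tends to [m0] while
    [`|unit_elt (m n)|] does not tend to infinity, then some [m n] is so close
    to [m0] compared with the norm of its unit that a whole neighbourhood of
    [m0] among the associative multiplications consists of unital ones, and
    [m0] is not a boundary point. *)

Import Order.TTheory GRing.Theory Num.Theory.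
Import numFieldNormedType.Exports.

Set Implicit Arguments.
Unset Strict Implicit.

Local Open Scope classical_set_scope.
Local Open Scope ring_scope.

(** * Neumann series *)

(** Since [scalar_field R s] is not known to be archimedean as an abstract
    ordered field, the geometric decay is brought back to [R]: nonnegative
    complex numbers are real. *)
Lemma cvg_expr_scalar (R : realType) (s : scalars) (q : scalar_field R s) :
  0 <= q < 1 -> q ^+ n @[n --> \oo] --> 0.
Proof.
case: s q => q /andP[q0 q1].
  by apply: cvg_expr; rewrite ger0_norm.
have qE : q = (complex.Re q)%:C%C.
  by case: q q0 {q1} => a b /=; rewrite lecE /= => /andP[/eqP-> _].
move: q0 q1; rewrite qE; move: (complex.Re q) => r {q qE}.
rewrite -(rmorph0 (real_complex R)) -(rmorph1 (real_complex R)) lecR ltcR.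
move=> r0 r1; apply/cvgr0Pnorm_lt => e e0.
have eE : e = (complex.Re e)%:C%C.
  by case: e e0 => a b /=; rewrite ltcE /= => /andP[/eqP-> _].
move: e0; rewrite eE; move: (complex.Re e) => d {e eE}.
rewrite -(rmorph0 (real_complex R)) ltcR => d0.
have r1' : `|r| < 1 by rewrite ger0_norm.
have /cvgr0Pnorm_lt/(_ d d0) := cvg_expr r1'; apply: filterS => n.
by rewrite -rmorphXn /= normc_def /= expr0n addr0 sqrtr_sqr ltcR.
Qed.

Section near_identity.
Variables (R : realType) (s : scalars) (E : completeNormedModType (scalar_field R s)).
Variables (f : E -> E) (q : scalar_field R s).
Hypothesis fB : {morph f : x y / x - y}.
Hypothesis q01 : 0 <= q < 1.
Hypothesis fq : forall x, `|f x - x| <= q * `|x|.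

Lemma le_norm_near_id x : (1 - q) * `|x| <= `|f x|.
Proof.
rewrite mulrBl mul1r lerBlDr -[in leLHS](subrKC (f x) x).
by rewrite (le_trans (ler_normD _ _))// lerD2l distrC.
Qed.

Lemma continuous_near_id : continuous f.
Proof.
have q1 : 0 < q + 1 by case/andP: q01 => *; rewrite ltr_wpDl.
move=> x; apply/cvgrPdist_lt => e e0; near=> y; rewrite -fB.
have : `|f (x - y)| <= (q + 1) * `|x - y|.
  rewrite -[f _](subrK (x - y)) (le_trans (ler_normD _ _))// mulrDl mul1r.
  by rewrite lerD2r.
move/le_lt_trans; apply.
rewrite mulrC -ltr_pdivlMr//; near: y.
by move: (divr_gt0 e0 q1); exact/cvgr_dist_lt/cvg_id.
Unshelve. all: by end_near. Qed.

(** Partial sums of the series of the [(id - f)^k y], written as the iteration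
    that adds the current residual to the current approximation of a
    solution of [f x = y]. *)
Fixpoint neumann_iter y n := if n is n'.+1 then
  neumann_iter y n' + (y - f (neumann_iter y n')) else 0.

(** Each iteration applies [id - f] to the residual, so the residuals decay
    geometrically and [y] is a limit of values of [f].  Since [f] is bounded
    below, the approximate solutions then form a Cauchy sequence, whose limit
    is a solution. *)
Lemma surjective_near_id y : exists x, f x = y.
Proof.
have [q0 q1] := andP q01.
have f0 : f 0 = 0 by have := fB 0 0; rewrite !subrr.
have fN x : f (- x) = - f x by rewrite -sub0r fB f0 sub0r.
have fD x z : f (x + z) = f x + f z by rewrite -{1}(opprK z) fB fN opprK.
pose x := neumann_iter y.
have res n : `|y - f (x n)| <= q ^+ n * `|y|.
  elim: n => [|n IH]; first by rewrite /= f0 subr0 expr0 mul1r.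
  (* With d := y - f (x n), the next residual is d - f d. *)
  rewrite /= -/(x n) fD opprD addrA distrC (le_trans (fq _))//.
  by rewrite exprS -mulrA ler_wpM2l.
have y1 : 0 < `|y| + 1 by rewrite ltr_wpDl.
have fx : f (x n) @[n --> \oo] --> y.
  apply/cvgrPdist_lt => e e0; near=> n.
  apply: le_lt_trans (res n) _.
  apply: (@le_lt_trans _ _ (q ^+ n * (`|y| + 1))).
    by rewrite ler_wpM2l ?exprn_ge0// lerDl.
  rewrite -ltr_pdivlMr//; near: n.
  have /cvgrPdist_lt/(_ (e / (`|y| + 1))) := cvg_expr_scalar q01.
  move=> /(_ (divr_gt0 e0 y1)); apply: filterS => n /=.
  by rewrite sub0r normrN ger0_norm// exprn_ge0.
have xcvg : cvg (x n @[n --> \oo]).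
  apply/cauchy_cvgP/cauchy_exP => e e0.
  have e'0 : 0 < (1 - q) * e / 2 by rewrite divr_gt0// mulr_gt0// subr_gt0.
  have /cvgrPdist_lt/(_ _ e'0)[N _ Nlt] := fx.
  exists (x N); exists N => // n Nn /=.
  rewrite -ball_normE /= -(@ltr_pM2l _ (1 - q)) ?subr_gt0//.
  apply: le_lt_trans (le_norm_near_id _) _; rewrite fB.
  rewrite -(subrKA y) [ltRHS]splitr (le_lt_trans (ler_normD _ _))// ltrD//.
    by rewrite distrC; exact: Nlt (leqnn N).
  exact: Nlt.
exists (limn x); apply: (@cvg_unique _ _ _ _ _ _ _ fx) => //.
by apply: (cvg_comp x f xcvg); exact: continuous_near_id.
Unshelve. all: by end_near. Qed.

End near_identity.

(** * Units of bounded multiplications *)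

Section B2_facts.
Variables (R : realType) (s : scalars) (E : normedModType (scalar_field R s)).
Implicit Types (m : B2 E) (e x y : E).

Lemma ler_B2_norm m x y : `|m x y| <= `|m| * `|x| * `|y|.
Proof.
have [->|x0] := eqVneq x 0; first by rewrite linear0l !normr0 mulr0 mul0r.
have [->|y0] := eqVneq y 0; first by rewrite linear0r !normr0 mulr0.
have := opnorm_ub (x := `|x|^-1 *: x) (y := `|y|^-1 *: y) (B2_bounded m).
rewrite !normfZV// => /(_ (lexx _) (lexx _)).
rewrite linearZl_LR linearZr_LR !normrZ !normfV !normr_id mulrA -invfM.
by rewrite ler_pdivrMl ?mulr_gt0 ?normr_gt0// mulrC -mulrA mulrC.
Qed.

Lemma unit_eltP m : Mltpu E m -> is_unit m (unit_elt m).
Proof. by case=> _ [e me]; rewrite /unit_elt; case: xgetP => // /(_ e). Qed.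

Lemma unit_dist m m' e e' : is_unit m e -> is_unit m' e' ->
  `|e - e'| <= `|m - m'| * `|e| * `|e'|.
Proof.
move=> [el _] [_ er'].
have -> : e - e' = (m' - m) e e' by rewrite -{1}(er' e) -{2}(el e').
by rewrite (distrC m m'); exact: ler_B2_norm.
Qed.
End B2_facts.

(** For [m'], the translations by [e] are surjective.  If [m' e u = e], then
    multiplying by [u] on the right fixes every product [m' x e], that is,
    every element; symmetrically on the other side, and a left and a right
    unit coincide. *)
Lemma Mltpu_near_unit (R : realType) (s : scalars)
    (E : completeNormedModType (scalar_field R s)) (m m' : B2 E) (e : E) :
  is_unit m e -> Mltp E m' -> `|m' - m| * `|e| < 1 -> Mltpu E m'.
Proof.
move=> [el er] m'A lt1; split=> //.
have lt01 : 0 <= `|m' - m| * `|e| < 1 by rewrite mulr_ge0.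
have Lsurj y : exists x, m' x e = y.
  apply: (surjective_near_id (linearBl m' e) lt01) => x.
  rewrite -[X in _ - X]er mulrAC; exact: (ler_B2_norm (m' - m)).
have Rsurj y : exists x, m' e x = y.
  apply: (surjective_near_id (linearBr m' e) lt01) => x.
  rewrite -[X in _ - X]el; exact: (ler_B2_norm (m' - m)).
have [u eu] := Rsurj e; have [v ve] := Lsurj e.
have ru : right_id u m' by move=> x; have [y <-] := Lsurj x; rewrite -m'A eu.
have lv : left_id v m' by move=> x; have [y <-] := Rsurj x; rewrite m'A ve.
have vu : v = u by rewrite -[LHS]ru lv.
by exists u; split; rewrite // -vu.
Qed.

Lemma continuous_unit_elt (R : realType) (s : scalars)
    (E : normedModType (scalar_field R s)) :
  {within Mltpu E, continuous (@unit_elt R s E)}.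
Proof.
apply/subspace_continuousP => m mU; set e := unit_elt m.
apply/cvgrPdist_lt => r r0.
(* With a := d * `|e|, the bound of unit_dist reads
   t <= a * (`|e| + t) for t := `|e - e'|, which yields t < r as soon as
   a * (`|e| + r) < r; taking d < r / M ensures this, also when e = 0. *)
pose M := (`|e| + 1) * (`|e| + r).
have M0 : 0 < M by rewrite mulr_gt0// ltr_wpDl.
have rM : 0 < r / M by rewrite divr_gt0.
apply: filterS (nbhsx_ballx m _ rM) => m'; rewrite -ball_normE /= => mm' m'U.
set e' := unit_elt m'; set d := `|m - m'| in mm'.
have d0 : 0 <= d by exact: normr_ge0.
have dist : `|e - e'| <= d * `|e| * (`|e| + `|e - e'|).
  apply: le_trans (unit_dist (unit_eltP mU) (unit_eltP m'U)) _.
  apply: ler_wpM2l; first by rewrite mulr_ge0.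
  by have := ler_normB e (e - e'); rewrite subKr.
have small : d * `|e| * (`|e| + r) < r.
  move: mm'; rewrite ltr_pdivlMr//; apply: le_lt_trans.
  by rewrite -mulrA ler_wpM2l// /M ler_wpM2r ?lerDl// addr_ge0// ltW.
have a0 : 0 <= d * `|e| by rewrite mulr_ge0.
move: (d * _) a0 dist small => a a0 dist small.
have {}small : a * `|e| < r * (1 - a).
  by rewrite mulrBr mulr1 ltrBrDr [r * a]mulrC -mulrDr.
have a1 : 0 < 1 - a.
  by rewrite -(pmulr_rgt0 _ r0); apply: le_lt_trans small; rewrite mulr_ge0.
rewrite -[X in X < _]/(`|e - e'|) -(ltr_pM2r a1); apply: le_lt_trans small.
by rewrite mulrBr mulr1 lerBlDr [_ * a]mulrC -mulrDr.
Qed.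

(** * The relative boundary *)

Lemma nbhs_ball_off_center (K : numFieldType) (V : normedModType K)
    (x y : V) (r : K) : `|x - y| < r -> nbhs x (ball y r).
Proof.
move=> xy; apply: open_nbhs_nbhs; split; first exact: ball_open.
by apply: ball_sym; rewrite -ball_normE.
Qed.

(** The points outside [A] are isolated in [subspace A], hence adherent only
    to sets that contain them. *)
Lemma boundary_in_sub (T : topologicalType) (A B : set T) (x : T) :
  B `<=` A -> boundary_in A B x -> A x.
Proof.
move=> BA [clB _]; apply: contrapT => xNA.
have /clB[y [/BA Ay yx]] : nbhs (x : subspace A) [set x].
  by apply: open_nbhs_nbhs; split; first exact: open_subspace1out.
by apply: xNA; rewrite -yx.
Qed.

Lemma boundary_in_not_nbhs (T : topologicalType) (A B : set T) (x : T) :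
  A x -> boundary_in A B x -> ~ nbhs x [set y | A y -> B y].
Proof.
move=> Ax [_ xNint] nbhsx; apply: xNint.
apply/(nbhs_subspace_ex B Ax); exists [set y | A y -> B y] => //.
by apply/seteqP; split=> y [By Ay]; split=> //; exact: By.
Qed.

(** * Continuity of the unit and its blow-up at the boundary *)

Theorem theorem3p4 (R : realType) (s : scalars)
    (E : completeNormedModType (scalar_field R s))
    (E_neq0 : exists x : E, x != 0) :
  {within Mltpu E, continuous (@unit_elt R s E)} /\
  (forall (m0 : B2 E) (m : nat -> B2 E),
     boundary_in (Mltp E) (Mltpu E) m0 ->
     (forall n, Mltpu E (m n)) ->
     m n @[n --> \oo] --> m0 ->
     `|unit_elt (m n)| @[n --> \oo] --> +oo).
Proof.
split; first exact: continuous_unit_elt.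
move=> m0 m m0bd mU mm0.
have m0A : Mltp E m0 by apply: boundary_in_sub m0bd => m' [].
apply/cvgryPger => A Ar.
have M0 : 0 < `|A| + 1 by rewrite ltr_wpDl.
(* If the norm of the unit of m n is below A, then it is below `|A| + 1, which
   is positive, so all associative elements of the ball of radius
   (`|A| + 1)^-1 about m n are unital; for large n this ball contains m0. *)
near=> n; have [//|eA] := real_leP Ar (normr_real (unit_elt (m n))).
exfalso; apply: (boundary_in_not_nbhs m0A m0bd).
have mn_near : `|m0 - m n| < (`|A| + 1)^-1.
  by near: n; apply: (iffLR (cvgrPdist_lt _ _) mm0); rewrite invr_gt0.
move: (nbhs_ball_off_center mn_near).
apply: filterS => m'; rewrite -ball_normE /= => mm' m'A.
apply: (@Mltpu_near_unit _ _ _ (m n) m' (unit_elt (m n))) => //.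
  exact: unit_eltP.
rewrite distrC; apply: (@le_lt_trans _ _ (`|m n - m'| * (`|A| + 1))).
  rewrite ler_wpM2l// (le_trans (ltW eA))// (le_trans (real_ler_norm Ar))//.
  by rewrite lerDl.
by rewrite -ltr_pdivlMr// mul1r.
Unshelve. all: by end_near. Qed.
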